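(* Let $\mathbb{O}$ be the real octonion division algebra and let $B\in M_2(\mathbb{O})$. Then $\sigma_L(B)\neq\emptyset$, i.e. the $2\times 2$ matrix $B$ always has a left eigenvalue.
   Context: For $B\in M_2(\mathbb{O})$, an element $\lambda\in\mathbb{O}$ is a left eigenvalue of $B$ if $B\vec v=\lambda\vec v$ for some nonzero column vector $\vec v\in\mathbb{O}^2$, where $\lambda$ multiplies each entry of $\vec v$ from the left; $\sigma_L(B)$ denotes the set of left eigenvalues of $B$. *)

(* Defs.v *)
From HB Require Import structures.
From mathcomp Require Import all_boot all_order all_algebra.
From mathcomp Require Import boolp classical_sets reals.
From mathcomp Require Import ring.

Set Implicit Arguments.
Unset Strict Implicit.
Unset Printing Implicit Defensive.

Import Order.TTheory GRing.Theory Num.Theory.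

Local Open Scope classical_set_scope.
Local Open Scope ring_scope.

(* Cayley-Dickson doubling of an algebra A with product mul and conjugation
   conj, both explicit: the product that MathComp infers on A * A is the
   componentwise one, and the iterated doubles are not associative rings. *)
Definition cd_conj (A : zmodType) (conj : A -> A) (x : A * A) : A * A :=
  (conj x.1, - x.2).

Definition cd_mul (A : zmodType) (conj : A -> A) (mul : A -> A -> A)
    (x y : A * A) : A * A :=
  (mul x.1 y.1 - mul (conj y.2) x.2, mul y.2 x.1 + mul x.2 (conj y.1)).

Definition cplx (R : realType) : Type := (R * R)%type.
HB.instance Definition _ (R : realType) :=
  GRing.Zmodule.copy (cplx R) (R * R)%type.

Definition cconj (R : realType) : cplx R -> cplx R := @cd_conj R id.
Definition cmul (R : realType) : cplx R -> cplx R -> cplx R :=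
  @cd_mul R id *%R.

Definition quaternion (R : realType) : Type := (cplx R * cplx R)%type.
HB.instance Definition _ (R : realType) :=
  GRing.Zmodule.copy (quaternion R) (cplx R * cplx R)%type.

Definition qconj (R : realType) : quaternion R -> quaternion R :=
  @cd_conj (cplx R) (@cconj R).
Definition qmul (R : realType) :
    quaternion R -> quaternion R -> quaternion R :=
  @cd_mul (cplx R) (@cconj R) (@cmul R).

Definition octonion (R : realType) : Type :=
  (quaternion R * quaternion R)%type.
HB.instance Definition _ (R : realType) :=
  GRing.Zmodule.copy (octonion R) (quaternion R * quaternion R)%type.

Definition oconj (R : realType) : octonion R -> octonion R :=
  @cd_conj (quaternion R) (@qconj R).
Definition omul (R : realType) : octonion R -> octonion R -> octonion R :=
  @cd_mul (quaternion R) (@qconj R) (@qmul R).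

Definition oreal (R : realType) (r : R) : octonion R :=
  (((r, 0), (0, 0)), ((0, 0), (0, 0))).

Definition onormsq (R : realType) (x : octonion R) : R :=
  let: (((a, b), (c, d)), ((e, f), (g, h))) := x in
  a ^+ 2 + b ^+ 2 + c ^+ 2 + d ^+ 2 + e ^+ 2 + f ^+ 2 + g ^+ 2 + h ^+ 2.

(* The matrix product *m is unavailable, as octonion R is not a ring. *)
Definition omulmx (R : realType) (m n p : nat)
    (B : 'M[octonion R]_(m, n)) (C : 'M[octonion R]_(n, p)) :
    'M[octonion R]_(m, p) :=
  \matrix_(i < m, k < p) \sum_(j < n) omul (B i j) (C j k).

Definition oscalemx (R : realType) (m n : nat) (l : octonion R)
    (C : 'M[octonion R]_(m, n)) : 'M[octonion R]_(m, n) :=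
  map_mx (omul l) C.

Definition left_eigenvalue (R : realType) (n : nat)
    (B : 'M[octonion R]_n) (l : octonion R) : Prop :=
  exists2 v : 'cV[octonion R]_n, v != 0 & omulmx B v = oscalemx l v.

Definition left_spectrum (R : realType) (n : nat)
    (B : 'M[octonion R]_n) : set (octonion R) :=
  [set l | left_eigenvalue B l].

(* The facts below identify omul as the octonion product: an 8-dimensional
   unital composition algebra with positive definite norm form is the octonion
   division algebra, by Hurwitz's theorem. *)
Lemma omul1o (R : realType) (x : octonion R) : omul (oreal 1) x = x.
Proof.
case: x => [[[a b] [c d]] [[e f] [g h]]].
by congr (((_, _), (_, _)), ((_, _), (_, _))) => /=; ring.
Qed.

Lemma omulo1 (R : realType) (x : octonion R) : omul x (oreal 1) = x.
Proof.
case: x => [[[a b] [c d]] [[e f] [g h]]].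
by congr (((_, _), (_, _)), ((_, _), (_, _))) => /=; ring.
Qed.

Lemma omul_conj (R : realType) (x : octonion R) :
  omul x (oconj x) = oreal (onormsq x).
Proof.
case: x => [[[a b] [c d]] [[e f] [g h]]].
by congr (((_, _), (_, _)), ((_, _), (_, _))) => /=; ring.
Qed.

Lemma omulDl (R : realType) (x y z : octonion R) :
  omul (x + y) z = omul x z + omul y z.
Proof.
case: x => [[[a b] [c d]] [[e f] [g h]]].
case: y => [[[a' b'] [c' d']] [[e' f'] [g' h']]].
case: z => [[[a'' b''] [c'' d'']] [[e'' f''] [g'' h'']]].
by congr (((_, _), (_, _)), ((_, _), (_, _))) => /=; ring.
Qed.

Lemma omulDr (R : realType) (x y z : octonion R) :
  omul x (y + z) = omul x y + omul x z.
Proof.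
case: x => [[[a b] [c d]] [[e f] [g h]]].
case: y => [[[a' b'] [c' d']] [[e' f'] [g' h']]].
case: z => [[[a'' b''] [c'' d'']] [[e'' f''] [g'' h'']]].
by congr (((_, _), (_, _)), ((_, _), (_, _))) => /=; ring.
Qed.

Lemma onormsqM (R : realType) (x y : octonion R) :
  onormsq (omul x y) = onormsq x * onormsq y.
Proof.
case: x => [[[a b] [c d]] [[e f] [g h]]].
case: y => [[[a' b'] [c' d']] [[e' f'] [g' h']]].
by rewrite /onormsq /=; ring.
Qed.

Lemma onormsq_eq0 (R : realType) (x : octonion R) :
  (onormsq x == 0) = (x == 0).
Proof.
apply/idP/eqP => [|->]; last by rewrite /onormsq /= !expr0n /= !addr0.
case: x => [[[a b] [c d]] [[e f] [g h]]].
rewrite /onormsq !paddr_eq0 ?addr_ge0 ?sqr_ge0 // !sqrf_eq0 -!andbA.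
by do 7!case/andP => /eqP->; move/eqP->.
Qed.

Lemma omul_eq0 (R : realType) (x y : octonion R) :
  (omul x y == 0) = (x == 0) || (y == 0).
Proof. by rewrite -!onormsq_eq0 onormsqM mulf_eq0. Qed.

(* Main.v *)
Require Import Defs.
From mathcomp Require Import all_boot all_order all_algebra.
From mathcomp Require Import boolp classical_sets reals.
From mathcomp Require Import ring lra polyrcf.

Local Open Scope classical_set_scope.
Local Open Scope ring_scope.

Import Order.TTheory GRing.Theory Num.Theory.

(* If b = 0, then (0, 1) is an eigenvector of the matrix (a b; c d).  Otherwise
   look for v = (1, y): then l = a + b y and the remaining equation is
   (b y) y + e y = c, where e = a - d.  If t = 2 Re y and n = |y|^2, then
   (b y) y = t (b y) - n b, so this equation reads (t b + e) y = c + n b, which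
   is solved for y without associativity.  Consistency requires t and n to be
   the trace and the norm of y = (t b + e)^-1 (c + n b): two real equations
   whose coefficients are inner products of b, e and c.  Eliminating n leaves
   one polynomial equation in t, to which the intermediate value theorem
   applies.  The only exception is when e and c are real multiples of b, and
   then a real quadratic equation, solvable in C, gives y. *)

Section RealSystem.
Context {R : realType}.

(** The polynomial X^n - q is monic, negative at 0 and positive far out, so it has a root s > 0. *)
Lemma exists_Xn_eq_horner (n : nat) (q : {poly R}) :
  (size q <= n)%N -> 0 < q.[0] -> exists2 s, 0 < s & s ^+ n = q.[s].
Proof.
move=> sq q0; pose p := 'X^n - q.
have lp : 0 < lead_coef p.
  by rewrite lead_coefDl ?lead_coefXn ?ltr01 // size_polyXn size_polyN ltnS.
have [M [M0 hM]] : exists M, 0 <= M /\ 0 <= p.[M].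
  have [M hM] := poly_pinfty_gt_lc lp; exists (Num.max M 0).
  rewrite le_max lexx orbT; split=> //.
  by apply: (le_trans (ltW lp)); apply: hM; rewrite le_max lexx.
have n0 : (0 < n)%N.
  rewrite lt0n; apply: contraTneq sq => ->; rewrite -ltnNge lt0n size_poly_eq0.
  by apply: contraTneq q0 => ->; rewrite horner0 ltxx.
have p0 : p.[0] = - q.[0] by rewrite !hornerE expr0n gtn_eqF // sub0r.
have [|s /andP[s0 _] ps] := @Num.Theory.poly_ivt R p 0 M M0.
  by rewrite p0 oppr_le0 ltW.
exists s; last by move/rootP: ps; rewrite !hornerE => /subr0_eq.
rewrite lt_neqAle s0 andbT; apply/eqP => s0'.
by move/rootP: ps q0; rewrite -s0' p0 => /eqP; rewrite oppr_eq0 => /eqP ->;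
  rewrite ltxx.
Qed.

(* Here b and g are the coordinates of the two other octonion coefficients along
   the leading one, and e, k and d are the Gram coefficients of their components
   orthogonal to it; the unknowns are s = t + b and m = n + g.  Eliminating m
   through 2 s m = (s - b) (s^2 + e) - 2 d leaves s^6 = q(s) with q even of
   degree at most 4 and q(0) = (b e + 2 d)^2.  If q(0) = 0, either
   s^4 = q(s) / s^2 has a positive root or s = 0 works, the second equation
   being then void and the first a quadratic in m. *)
Lemma trace_norm_system (b g d e k : R) : 0 <= e -> 0 <= k ->
  (e == 0) && (k == 0) \/
  exists s m, [/\ 0 < s ^+ 2 + e,
    (m - g) * (s ^+ 2 + e) = m ^+ 2 + k &
    (s - b) * (s ^+ 2 + e) = 2 * (s * m + d)].
Proof.
move=> e0 k0.
pose c0 := b * e + 2 * d.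
pose c2 := 2 * b * c0 - e ^+ 2 + 4 * k + 4 * g * e.
pose c4 := b ^+ 2 - 2 * e + 4 * g.
suff: (e == 0) && (k == 0) \/ (exists m, [/\ 0 < e,
    (m - g) * e = m ^+ 2 + k & c0 = 0]) \/
    exists2 s, 0 < s & s ^+ 6 = c0 ^+ 2 + c2 * s ^+ 2 + c4 * s ^+ 4.
  case=> [|[[m [e0' mE c00]]|[s s0 sE]]]; [by left| |]; right.
    exists 0, m; rewrite expr0n add0r; split=> //.
    by rewrite sub0r mul0r add0r; move: c00; rewrite /c0; lra.
  have sn0 : s != 0 by rewrite gt_eqF.
  pose m := ((s - b) * (s ^+ 2 + e) - 2 * d) / (2 * s).
  have mE : 2 * s * m = (s - b) * (s ^+ 2 + e) - 2 * d by rewrite /m; field.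
  exists s, m; split; [by have := exprn_gt0 2 s0; lra| |by lra].
  (* Multiplying by 4 s^2 leaves m only in the form 2 s m, which [mE] eliminates; the difference of
     the two sides is then s^6 - q(s). *)
  have s2n0 : 4 * s ^+ 2 != 0 by rewrite mulf_neq0 ?expf_neq0 // pnatr_eq0.
  apply: (mulfI s2n0); apply/eqP; rewrite -subr_eq0; apply/eqP.
  have -> : 4 * s ^+ 2 * ((m - g) * (s ^+ 2 + e)) - 4 * s ^+ 2 * (m ^+ 2 + k) =
    2 * s * (2 * s * m - 2 * s * g) * (s ^+ 2 + e) -
    ((2 * s * m) ^+ 2 + 4 * s ^+ 2 * k) by ring.
  rewrite mE; apply: etrans (subrr (s ^+ 6)); rewrite [X in _ = _ - X]sE.
  by rewrite /c4 /c2 /c0; ring.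
have [c00|c00] := eqVneq c0 0; last first.
  have sq : (size (Poly [:: c0 ^+ 2; 0%R; c2; 0%R; c4]) <= 6)%N.
    exact: leq_trans (size_Poly _) _.
  have [|s s0 sE] := exists_Xn_eq_horner _ _ sq; rewrite ?horner_Poly /=.
    by rewrite mulr0 add0r lt_neqAle sqr_ge0 eq_sym expf_neq0.
  by right; right; exists s => //; rewrite sE horner_Poly /=; ring.
have [c20|c20] := ltP 0 c2.
  have sq : (size (Poly [:: c2; 0%R; c4]) <= 4)%N.
    exact: leq_trans (size_Poly _) _.
  have [|s s0 sE] := exists_Xn_eq_horner _ _ sq; rewrite ?horner_Poly /=.
    by rewrite mulr0 add0r.
  right; right; exists s => //; rewrite c00 (exprD s 4 2).
  by rewrite [X in X * _]sE horner_Poly /=; ring.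
move: c20; rewrite /c2 c00 => c20.
have [e00|en0] := eqVneq e 0.
  left; move: c20; rewrite e00 => h; apply/andP; split=> //.
  by rewrite eq_le k0 andbT; lra.
right; left.
(* [D] is the discriminant of m^2 - e m + k + g e, the first equation at s = 0; [c20] makes it
   nonnegative. *)
pose D := e ^+ 2 - 4 * (k + g * e).
have D0 : 0 <= D by rewrite /D; lra.
exists ((e + Num.sqrt D) / 2); split=> //; first by rewrite lt_neqAle eq_sym en0.
have := sqr_sqrtr D0; rewrite {2}/D => h.
pose r := Num.sqrt D; rewrite -/r in h *.
have -> : k = (e ^+ 2 - r ^+ 2) / 4 - g * e by rewrite h; field.
by field.
Qed.

End RealSystem.

Section OctonionQuadratic.
Context {R : realType}.
Implicit Types (b c e u v w x y : octonion R) (r s t n : R).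

Definition oscale r x : octonion R := omul (oreal r) x.

Definition ore x : R := x.1.1.1.

(** The Euclidean inner product of R^8, polarizing [onormsq]. *)
Definition odot x y : R := ore (omul (oconj x) y).

Ltac ocase x := case: x => [[[? ?] [? ?]] [[? ?] [? ?]]].
Ltac oring := congr (((_, _), (_, _)), ((_, _), (_, _))) => /=; ring.

Lemma omul_oscalel r x y : omul (oscale r x) y = oscale r (omul x y).
Proof. by ocase x; ocase y; oring. Qed.

Lemma omul_oscaler r x y : omul x (oscale r y) = oscale r (omul x y).
Proof. by ocase x; ocase y; oring. Qed.

Lemma oscalerDl r s x : oscale (r + s) x = oscale r x + oscale s x.
Proof. by ocase x; oring. Qed.

Lemma oscaleA r s x : oscale r (oscale s x) = oscale (r * s) x.
Proof. by ocase x; oring. Qed.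

Lemma oscale0 x : oscale 0 x = 0.
Proof. by ocase x; oring. Qed.

Lemma oscaleN1 x : oscale (-1) x = - x.
Proof. by ocase x; oring. Qed.

Lemma oscale1 x : oscale 1 x = x.
Proof. exact: omul1o. Qed.

(** Left alternativity suffices, since the conjugate of u is 2 Re u - u. For nonzero u this solves u
    y = w. *)
Lemma omul_oconjK u w : omul u (omul (oconj u) w) = oscale (onormsq u) w.
Proof. by ocase u; ocase w; oring. Qed.

Lemma onormsq_oconj x : onormsq (oconj x) = onormsq x.
Proof. by ocase x; rewrite /onormsq /=; ring. Qed.

Lemma onormsq_oscale r x : onormsq (oscale r x) = r ^+ 2 * onormsq x.
Proof. by ocase x; rewrite /onormsq /=; ring. Qed.

Lemma onormsq_ge0 x : 0 <= onormsq x.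
Proof. by ocase x; rewrite /onormsq !addr_ge0 // sqr_ge0. Qed.

Lemma onormsq_oscaleD r x y :
  onormsq (oscale r x + y) = r ^+ 2 * onormsq x + 2 * r * odot x y + onormsq y.
Proof. by ocase x; ocase y; rewrite /onormsq /odot /ore /=; ring. Qed.

Lemma ore_oscale r x : ore (oscale r x) = r * ore x.
Proof. by ocase x; rewrite /ore /=; ring. Qed.

Lemma odotC x y : odot x y = odot y x.
Proof. by ocase x; ocase y; rewrite /odot /ore /=; ring. Qed.

Lemma odotDr x y w : odot x (y + w) = odot x y + odot x w.
Proof. by rewrite /odot omulDr. Qed.

Lemma odotZr r x y : odot x (oscale r y) = r * odot x y.
Proof. by rewrite /odot omul_oscaler ore_oscale. Qed.

Lemma odotxx x : odot x x = onormsq x.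
Proof. by ocase x; rewrite /onormsq /odot /ore /=; ring. Qed.

(** Right alternativity turns (b y) y into b y^2, and y^2 = 2 Re(y) y - |y|^2. *)
Lemma omul_sqr b y :
  omul (omul b y) y = oscale (2 * ore y) (omul b y) - oscale (onormsq y) b.
Proof. by ocase b; ocase y; rewrite /onormsq /ore; oring. Qed.

(** By right alternativity a real or complex root of y^2 + r y = s suffices. *)
Lemma real_quadratic_solvable b r s :
  exists y, omul (omul b y) y + omul (oscale r b) y = oscale s b.
Proof.
have [D0|D0] := leP 0 (r ^+ 2 / 4 + s).
  pose p := Num.sqrt (r ^+ 2 / 4 + s) - r / 2.
  have pE : s = p ^+ 2 + r * p.
    rewrite /p; have := sqr_sqrtr D0; set q := Num.sqrt _ => qE.
    have -> : s = q ^+ 2 - r ^+ 2 / 4 by rewrite qE; field.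
    by field.
  exists (oreal p); rewrite pE; ocase b; oring.
pose q := Num.sqrt (- (r ^+ 2 / 4 + s)).
have sE : s = - (r / 2) ^+ 2 - q ^+ 2.
  by rewrite /q sqr_sqrtr ?oppr_ge0 ?(ltW D0) //; field.
exists (((- (r / 2), q), 0), 0); rewrite omul_sqr omul_oscalel.
have -> : onormsq (((- (r / 2), q), 0), 0) = - s.
  by rewrite sE /onormsq /=; ring.
have -> : 2 * ore (((- (r / 2), q), 0), 0) = - r by rewrite /ore /=; field.
by rewrite addrAC -oscalerDl addNr oscale0 add0r -oscaleN1 oscaleA mulN1r opprK.
Qed.

(** Take y = u^-1 w: the hypotheses say that |y|^2 = n and 2 Re y = t, so [omul_sqr] turns u y = w
    into the equation. *)
Lemma quadratic_solution_of_trace_norm b e c t n :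
  let u := oscale t b + e in let w := oscale n b + c in
  0 < onormsq u -> n * onormsq u = onormsq w ->
  t * onormsq u = 2 * odot u w ->
  exists y, omul (omul b y) y + omul e y = c.
Proof.
move=> u w u0 nE tE; have un0 : onormsq u != 0 by rewrite gt_eqF.
pose y := oscale (onormsq u)^-1 (omul (oconj u) w); exists y.
have yn : onormsq y = n.
  by rewrite onormsq_oscale onormsqM onormsq_oconj -nE; field.
have yt : 2 * ore y = t.
  by rewrite ore_oscale -/(odot u w) mulrCA -tE mulrC mulfK.
have uy : omul u y = w.
  by rewrite omul_oscaler omul_oconjK oscaleA mulVf // oscale1.
move: uy; rewrite omul_sqr yn yt /u /w omulDl omul_oscalel addrAC => ->.
by rewrite addrC addKr.
Qed.

Lemma quadratic_solvable b e c : b != 0 ->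
  exists y, omul (omul b y) y + omul e y = c.
Proof.
move=> bn0; set nu := onormsq b.
have nun0 : nu != 0 by rewrite onormsq_eq0.
have nu0 : 0 < nu by rewrite lt_neqAle eq_sym nun0 onormsq_ge0.
have orthb x : exists r x', x = oscale r b + x' /\ odot b x' = 0.
  exists (odot b x / nu), (oscale (- (odot b x / nu)) b + x); split.
    by rewrite addrA -oscalerDl subrr oscale0 add0r.
  by rewrite odotDr odotZr odotxx -/nu mulNr divfK // addNr.
have [be [e' [-> be0]]] := orthb e; have [ga [c' [-> bc0]]] := orthb c.
have ge0_div x : 0 <= onormsq x / nu by rewrite divr_ge0 ?onormsq_ge0 // ltW.
(* Inner products are divided by |b|^2, as if b were a unit. The first alternative means e' = c' =
   0, the exceptional case. *)
have [/andP[]|[s [m [Q0 nE tE]]]] :=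
    trace_norm_system be ga (odot e' c' / nu) _ _ (ge0_div e') (ge0_div c').
  rewrite !mulf_eq0 invr_eq0 (negPf nun0) !orbF !onormsq_eq0.
  move=> /eqP -> /eqP ->; rewrite !addr0; exact: real_quadratic_solvable.
have normD r x : odot b x = 0 ->
    onormsq (oscale r b + x) = nu * (r ^+ 2 + onormsq x / nu).
  by move=> bx0; rewrite onormsq_oscaleD bx0 -/nu; field.
have shift r r' x : oscale (r - r') b + (oscale r' b + x) = oscale r b + x.
  by rewrite addrA -oscalerDl subrK.
(* With t = s - be and n = m - ga, u and w become s b + e' and m b + c'. *)
apply: (@quadratic_solution_of_trace_norm _ _ _ (s - be) (m - ga)); cbv zeta;
  rewrite !shift !normD //.
- by rewrite mulr_gt0.
- by rewrite mulrCA nE.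
- rewrite mulrCA tE mulrCA; congr (_ * _).
  rewrite odotDr odotZr ![odot (_ + _) _]odotC !odotDr !odotZr odotxx -/nu.
  by rewrite [odot c' b]odotC bc0 be0 [odot c' e']odotC; field.
Qed.

End OctonionQuadratic.

Theorem corollary3p6 (R : realType) (B : 'M[octonion R]_2) :
  left_spectrum B !=set0.
Proof.
have omulo0 (x : octonion R) : omul x 0 = 0.
  by apply/eqP; rewrite omul_eq0 eqxx orbT.
have omulmxE (v : 'cV[octonion R]_2) i :
    omulmx B v i 0 = omul (B i 0) (v 0 0) + omul (B i 1) (v 1 0).
  rewrite mxE big_ord_recl big_ord1.
  by congr (_ + omul (B i _) (v _ _)); apply: val_inj.
have colP2 (u v : 'cV[octonion R]_2) : u 0 0 = v 0 0 -> u 1 0 = v 1 0 -> u = v.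
  move=> u0 u1; apply/colP => -[[|[|//]] hi].
    by rewrite (_ : Ordinal hi = 0) //; apply: val_inj.
  by rewrite (_ : Ordinal hi = 1) //; apply: val_inj.
have one_neq0 : oreal 1 != 0 :> octonion R.
  by rewrite -onormsq_eq0 /onormsq /= !expr0n !addr0 expr1n oner_neq0.
pose vec (x y : octonion R) : 'cV_2 := \col_i if i == 0 then x else y.
have vec0 x y : vec x y 0 0 = x by rewrite mxE.
have vec1 x y : vec x y 1 0 = y by rewrite mxE.
have [b0|bn0] := eqVneq (B 0 1) 0.
  exists (B 1 1), (vec 0 (oreal 1)).
    by apply: contraNneq one_neq0 => v0; rewrite -(vec1 0 (oreal 1)) v0 mxE.
  apply: colP2; rewrite omulmxE [RHS]mxE vec0 vec1 !omulo0 add0r ?b0 //.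
  by rewrite omulo1.
have [y yE] := quadratic_solvable _ (B 0 0 - B 1 1) (B 1 0) bn0.
(* The first row forces this eigenvalue for (1, y); [yE] yields the second row. *)
exists (B 0 0 + omul (B 0 1) y), (vec (oreal 1) y).
  by apply: contraNneq one_neq0 => v0; rewrite -(vec0 (oreal 1) y) v0 mxE.
apply: colP2; rewrite omulmxE [RHS]mxE vec0 vec1 !omulo1 //.
by rewrite -yE -addrA -omulDl subrK addrC omulDl.
Qed.
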